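(* Let $K$ be a field, let $\mathbf{x}=x_1,\dots,x_n$ be indeterminates, let $\mathbf{f}(\mathbf{x})\subset K[\mathbf{x}]$ be a zero-dimensional complete intersection of $n$ polynomials, and let $F(\mathbf{a},\mathbf{x})=\{F_1(\mathbf{a},\mathbf{x}),\dots,F_n(\mathbf{a},\mathbf{x})\}\subset K[\mathbf{a},\mathbf{x}]$ be a generically zero-dimensional family containing $\mathbf{f}(\mathbf{x})$. Let $\mathcal{S}=\mathbb{A}^m_K$ be the scheme of the independent parameters $\mathbf{a}=(a_1,\dots,a_m)$, let $I(\mathbf{a},\mathbf{x})$ be the ideal generated by $F(\mathbf{a},\mathbf{x})$ in $K[\mathbf{a},\mathbf{x}]$, let $D(\mathbf{a},\mathbf{x})=\det(\mathrm{Jac}_F(\mathbf{a},\mathbf{x}))$ be the determinant of the Jacobian matrix of $F(\mathbf{a},\mathbf{x})$ with respect to the indeterminates $\mathbf{x}$, let $J(\mathbf{a},\mathbf{x})=I(\mathbf{a},\mathbf{x})+(D(\mathbf{a},\mathbf{x}))$ in $K[\mathbf{a},\mathbf{x}]$, and let $H=J(\mathbf{a},\mathbf{x})\cap K[\mathbf{a}]$. (a) There exists an $I$-smooth subscheme of $\mathcal{S}$ if and only if $H\neq(0)$. (b) If $0\neq h(\mathbf{a})\in H$, then the open subscheme of $\mathcal{S}$ defined by the inequality $h(\mathbf{a})\neq 0$ is $I$-smooth.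
   Context: A set of $t$ polynomials in $K[x_1,\dots,x_n]$ generating an ideal $I$ is a complete intersection if $\dim(K[\mathbf{x}]/I)=n-t$; it is a zero-dimensional complete intersection if moreover $t=n$. Families: $F(\mathbf{a},\mathbf{x})=\{F_1,\dots,F_n\}\subset K[\mathbf{a},\mathbf{x}]$ is a family of polynomial systems parametrized by $\mathbf{a}$, $I(\mathbf{a},\mathbf{x})$ is the ideal it generates in $K[\mathbf{a},\mathbf{x}]$, $\mathcal{S}=\mathbb{A}^m_K=\operatorname{Spec}K[\mathbf{a}]$ is the parameter scheme, and $\Phi:\operatorname{Spec}(K[\mathbf{a},\mathbf{x}]/I(\mathbf{a},\mathbf{x}))\to\mathcal{S}$ is the associated morphism. The parameters are independent if $\mathcal{S}=\mathbb{A}^m_K$ and $I(\mathbf{a},\mathbf{x})\cap K[\mathbf{a}]=(0)$. $F(\mathbf{a},\mathbf{x})$ is a generically zero-dimensional family containing $\mathbf{f}(\mathbf{x})$ if $\mathbf{f}(\mathbf{x})$ is a zero-dimensional complete intersection which is a member of the family (i.e. $\mathbf{f}(\mathbf{x})=F(\alpha,\mathbf{x})$ for some parameter value $\alpha$) and the generic member of the family is a zero-dimensional complete intersection (in particular $K(\mathbf{a})[\mathbf{x}]/I(\mathbf{a},\mathbf{x})K(\mathbf{a})[\mathbf{x}]$ is a finite-dimensional $K(\mathbf{a})$-vector space). A dense Zariski-open subscheme $\mathcal{U}$ of $\mathcal{S}$ is called an $I$-smooth subscheme of $\mathcal{S}$ if $\Phi^{-1}(\mathcal{U})\to\mathcal{U}$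 is smooth, i.e. all the fibers of $\Phi^{-1}(\mathcal{U})\to\mathcal{U}$ are zero-dimensional smooth complete intersections.
   Formalization: In an I-smooth subscheme, empty fibers are allowed: only nonempty fibers must be zero-dimensional smooth complete intersections. Read for all fibers, (b) fails for F = ax − 1, f = x − 1, h = 1, whose fiber over a = 0 is empty. *)

(* Defs.v *)
From HB Require Import structures.
From mathcomp Require Import all_boot all_order all_algebra.
From mathcomp Require Import generic_quotient ring_quotient fraction.
From mathcomp Require Export mpoly.
From Stdlib Require Import ClassicalEpsilon.

Set Implicit Arguments.
Unset Strict Implicit.
Unset Printing Implicit Defensive.

Import GRing.Theory.
Local Open Scope ring_scope.

(* K[a, x] is rendered as K[a][x] = {mpoly {mpoly K[m]}[n]}, in which K[a] is
   the subring of the constants c%:MP. *)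

Definition gen_ideal (R : comNzRingType) (t : nat) (f : 'I_t -> R) : R -> Prop :=
  fun r => exists c : 'I_t -> R, r = \sum_(i < t) c i * f i.

Definition jacobian (R : comNzRingType) (n : nat) (F : 'I_n -> {mpoly R[n]}) :
    {mpoly R[n]} :=
  \det (\matrix_(i < n, j < n) (F i)^`M(j)).

(* The ideal J = I + (D). *)
Definition jac_ideal (R : comNzRingType) (n : nat) (F : 'I_n -> {mpoly R[n]}) :
    {mpoly R[n]} -> Prop :=
  fun p => exists q g, gen_ideal F q /\ p = q + g * jacobian F.

(* Membership in H = J \cap R, where R is the ring of coefficients. *)
Definition elim_ideal (R : comNzRingType) (n : nat) (F : 'I_n -> {mpoly R[n]}) :
    R -> Prop :=
  fun c => jac_ideal F c%:MP.

(* A point of Spec R is a [prime_idealr R]; its membership predicate is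
   boolean, which is no restriction classically. *)

Definition zariski_open (R : comNzRingType) (U : prime_idealr R -> Prop) : Prop :=
  exists E : R -> Prop,
    forall p : prime_idealr R, U p <-> (exists2 r, E r & r \notin p).

Definition zariski_dense (R : comNzRingType) (U : prime_idealr R -> Prop) : Prop :=
  forall V : prime_idealr R -> Prop, zariski_open V ->
    (exists p, V p) -> exists p, U p /\ V p.

Definition basic_open (R : comNzRingType) (h : R) : prime_idealr R -> Prop :=
  fun p => h \notin p.

(* A chain of length d of primes of R / I, seen as primes of R containing I. *)
Definition prime_chain (R : comNzRingType) (I : R -> Prop) (d : nat)
    (P : nat -> prime_idealr R) : Prop :=
  (forall i, (i <= d)%N -> forall r, I r -> r \in P i) /\
  (forall i, (i < d)%N ->
     {subset P i <= P i.+1} /\ ~ {subset P i.+1 <= P i}).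

(* The Krull dimension of R / I is d; false for every d if R / I = 0. *)
Definition quot_krull_dim (R : comNzRingType) (I : R -> Prop) (d : nat) : Prop :=
  (exists P, prime_chain I d P) /\ ~ (exists P, prime_chain I d.+1 P).

Definition complete_intersection (L : fieldType) (n t : nat)
    (f : 'I_t -> {mpoly L[n]}) : Prop :=
  exists2 d : nat, quot_krull_dim (gen_ideal f) d & (d + t)%N = n.

Definition zero_dim_ci (L : fieldType) (n : nat) (f : 'I_n -> {mpoly L[n]}) : Prop :=
  complete_intersection f.

Definition independent_params (R : comNzRingType) (n : nat)
    (F : 'I_n -> {mpoly R[n]}) : Prop :=
  forall c : R, gen_ideal F c%:MP -> c = 0.

Definition specialize (R S : comNzRingType) (phi : R -> S) (n t : nat)
    (F : 'I_t -> {mpoly R[n]}) : 'I_t -> {mpoly S[n]} :=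
  fun i => map_mpoly phi (F i).

Definition generically_zero_dim_family (K : fieldType) (m n : nat)
    (F : 'I_n -> {mpoly {mpoly K[m]}[n]}) (f : 'I_n -> {mpoly K[n]}) : Prop :=
  [/\ zero_dim_ci f,
      exists alpha : 'I_m -> K, specialize (meval alpha) F =1 f
    & zero_dim_ci (specialize (@FracField.tofrac {mpoly K[m]}) F)].

(* The ring R / p as an integral domain; units have to be decided classically. *)
Section ResidueField.
Variables (R : comNzRingType) (p : prime_idealr R).

Definition residue_domain : Type := {ideal_quot p}.
HB.instance Definition _ := GRing.ComNzRing.on residue_domain.

Let is_unit (x : residue_domain) : Prop := exists y, y * x = 1.
Definition residue_unit (x : residue_domain) : bool :=
  if excluded_middle_informative (is_unit x) then true else false.
Definition residue_inv (x : residue_domain) : residue_domain :=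
  match excluded_middle_informative (is_unit x) with
  | left ux => sval (constructive_indefinite_description _ ux)
  | right _ => x
  end.

Fact residue_mulVx : {in residue_unit, left_inverse 1 residue_inv *%R}.
Proof.
move=> x; rewrite unfold_in /residue_unit /residue_inv.
case: excluded_middle_informative => // ux _.
by case: constructive_indefinite_description.
Qed.

Fact residue_unitP (x y : residue_domain) : y * x = 1 -> residue_unit x.
Proof.
move=> yx; rewrite /residue_unit.
by case: excluded_middle_informative => // -[]; exists y.
Qed.

Fact residue_inv_out : {in [predC residue_unit], residue_inv =1 id}.
Proof.
move=> x; rewrite inE unfold_in /residue_unit /residue_inv.
by case: excluded_middle_informative.
Qed.

HB.instance Definition _ := GRing.ComNzRing_hasMulInverse.Build residue_domain
  residue_mulVx residue_unitP residue_inv_out.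
HB.instance Definition _ := GRing.ComUnitRing_isIntegral.Build residue_domain
  (@Quotient.rquot_IdomainAxiom R p).

Definition residue_field : fieldType := {fraction residue_domain}.

Definition to_residue_field (r : R) : residue_field :=
  FracField.tofrac (\pi_({ideal_quot p})%qT r : residue_domain).

End ResidueField.

(* The equations over the residue field k(p) of the fibre over p. *)
Definition fiber (R : comNzRingType) (n t : nat) (F : 'I_t -> {mpoly R[n]})
    (p : prime_idealr R) : 'I_t -> {mpoly (residue_field p)[n]} :=
  specialize (@to_residue_field R p) F.

Definition square_zero_ideal (B : comNzRingType) (N : B -> Prop) : Prop :=
  [/\ N 0, forall u v, N u -> N v -> N (u + v), forall b u, N u -> N (b * u)
    & forall u v, N u -> N v -> u * v = 0].

(* Smoothness over the open subscheme U of Spec R of the restriction to U of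
   Spec (R[x] / (F)) -> Spec R. As this morphism is of finite presentation,
   smoothness is formal smoothness (EGA IV, 17.3.1): for each affine scheme
   Spec B over U (a ring morphism phi from R to B such that Spec B -> Spec R
   has its image in U) and each ideal N of B of square zero, each U-morphism
   from Spec (B / N) (a tuple b with values in B solving F modulo N) lifts to
   Spec B. *)
Definition smooth_above (R : comNzRingType) (U : prime_idealr R -> Prop)
    (n t : nat) (F : 'I_t -> {mpoly R[n]}) : Prop :=
  forall (B : comNzRingType) (phi : {rmorphism R -> B}),
    (forall (q : prime_idealr B) (p : prime_idealr R),
       (forall r, (r \in p) = (phi r \in q)) -> U p) ->
  forall N : B -> Prop, square_zero_ideal N ->
  forall b : 'I_n -> B, (forall i, N (mmap phi b (F i))) ->
  exists2 b' : 'I_n -> B,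
    forall j, N (b' j - b j) & forall i, mmap phi b' (F i) = 0.

Definition smooth (R : comNzRingType) (n t : nat) (F : 'I_t -> {mpoly R[n]}) : Prop :=
  smooth_above (fun=> True) F.

(* Empty fibres are allowed, as they are for smooth morphisms: for F = a x - 1
   one has 1 \in H, but the fibre over a = 0 is empty. *)
Definition I_smooth (R : comNzRingType) (n : nat) (F : 'I_n -> {mpoly R[n]})
    (U : prime_idealr R -> Prop) : Prop :=
  [/\ zariski_open U, zariski_dense U, smooth_above U F
    & forall p, U p -> ~ gen_ideal (fiber F p) 1 ->
        zero_dim_ci (fiber F p) /\ smooth (fiber F p)].

(* Main.v *)
Require Import Defs.
From HB Require Import structures.
From mathcomp Require Import all_boot all_order all_algebra.
From mathcomp Require Import generic_quotient ring_quotient fraction.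
From mathcomp Require Import ring.
From mathcomp Require boolp classical_sets.

(** Suppose [h] is a nonzero element of [H], so that [h = q + g D] with [q] in
    the ideal [I] of the equations. Above the open set [h <> 0], [h] is a unit,
    hence so is the Jacobian determinant [D] at every solution modulo a
    square-zero ideal, and one step of Newton's method lifts this solution
    ([newton_lift], [smooth_above_elim]). The same argument applies to the fibres,
    where [h] is a nonzero constant of a field [L]. That a nonempty fibre has
    dimension zero means that no prime [P] above [I] lies strictly below another
    prime [Q]. As [D] is nonzero at the generic point [xi] of [Q], Hadamard's
    lemma and Cramer's rule give a polynomial [s] with [s(xi) = D(xi)] such that
    all the [s (X_j - xi_j)] are combinations of the equations: the point [xi] is
    isolated. An element [r] of [Q] vanishes at [xi], so [r s] is such a
    combination; if [r] were not in [P], it could be cancelled modulo [P], because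
    extension of scalars from a field is flat, and [s] would vanish at [xi]
    ([kernel_sub_prime], [zero_dim_elim]). This is (b), and half of (a).

    Conversely, a dense open set [U] contains the generic point of the parameter
    space. Let [L] be its residue field. It suffices that [1] be in [I + (D)] over
    [L], since clearing denominators then yields a nonzero element of [H]. This is
    so if the fibre over this point is empty; if it is smooth of dimension zero,
    suppose on the contrary that some maximal ideal [M] of [L[x]] contains
    [I + (D)], and let [k] be its residue field and [xi] its point in [k^n].
    The Jacobian matrix is singular at [xi], so there is a tangent vector
    [v <> 0], and smoothness prolongs [xi + v t] to solutions modulo every power
    of [t] ([formal_curve]). The polynomials that vanish along this formal curve
    form a prime [Q] between [I] and [M]. It differs from [M], since the
    coordinates of [xi] are algebraic over [L] ([zariski]) whereas a nonzero
    polynomial in one variable over [L] cannot vanish on a moving coordinate of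
    the curve. The chain [Q < M] contradicts the dimension being zero. *)

Set Implicit Arguments.
Unset Strict Implicit.
Unset Printing Implicit Defensive.

Import GRing.Theory.
Local Open Scope ring_scope.

(** * Primes and ideals *)

Section PackIdeals.
Variables (R : comNzRingType) (S : R -> bool).

Definition pack_ideal (idS : idealr_closed S) : idealr R :=
  HB.pack S (isIdealr.Build R S idS).

Definition pack_prime (idS : idealr_closed S) (prS : prime_idealr_closed S) :
    prime_idealr R :=
  HB.pack S (isIdealr.Build R S idS) (isPrimeIdealrClosed.Build R S prS).

End PackIdeals.

(** Maximality is recorded in the form in which it makes the quotient a field. *)
Definition maximal_prime (R : comNzRingType) (p : prime_idealr R) : Prop :=
  forall x, x \notin p -> exists y, 1 - y * x \in p.

Record ideal_pred (R : comNzRingType) (I : R -> Prop) : Prop := IdealPred {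
  ideal_pred0 : I 0;
  ideal_predD : forall u v, I u -> I v -> I (u + v);
  ideal_predM : forall a u, I u -> I (a * u) }.

(** Krull's theorem, by Zorn's lemma on the proper ideals containing [I]. *)
Lemma exists_maximal_prime (R : comNzRingType) (I : R -> Prop) :
  ideal_pred I -> ~ I 1 ->
  exists2 p : prime_idealr R, maximal_prime p & forall r, I r -> r \in p.
Proof.
move=> idI I1.
pose T := {S : R -> Prop | [/\ ideal_pred S, ~ S 1 & forall r, I r -> S r]}.
have t0 : T by exists I.
pose le (s t : T) := boolp.asbool (forall r, sval s r -> sval t r).
have [] := @classical_sets.ZL_preorder T t0 le.
- by move=> t; apply/boolp.asboolP.
- by move=> s r t /boolp.asboolP sr /boolp.asboolP rt; apply/boolp.asboolP; auto.
- move=> A totA.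
  have [[a0 Aa0]|nA] := boolp.pselect (exists a, A a); last first.
    by exists t0 => s As; case: nA; exists s.
  pose S r := exists2 s : T, A s & sval s r.
  suff PS : [/\ ideal_pred S, ~ S 1 & forall r, I r -> S r].
    by exists (exist _ S PS) => s As; apply/boolp.asboolP => r sr; exists s.
  split.
  + split.
    * by exists a0 => //; case: (svalP a0) => -[].
    * move=> u v [s As su] [t At tv].
      have [/boolp.asboolP st|/boolp.asboolP ts] := totA s t As At.
      - by exists t => //; case: (svalP t) => -[_ D _] _ _; apply: D => //; apply: st.
      - by exists s => //; case: (svalP s) => -[_ D _] _ _; apply: D => //; apply: ts.
    * by move=> a u [s As su]; exists s => //; case: (svalP s) => -[_ _ M] _ _; apply: M.
  + by case=> s _; case: (svalP s).
  + by move=> r Ir; exists a0 => //; case: (svalP a0) => _ _; apply.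
move=> [M [idM M1 IM]] maxM; case: (idM) => M0 MD MM.
pose S : R -> bool := fun r => boolp.asbool (M r).
have SE r : r \in S = S r by [].
(* Otherwise the ideal generated by the maximal one and [x] is proper. *)
have inv x : x \notin S -> exists y, 1 - y * x \in S.
  rewrite SE => /boolp.asboolP nMx.
  apply: boolp.contrapT => ninv; apply: nMx.
  pose M' r := exists a m, M m /\ r = a * x + m.
  have PM' : [/\ ideal_pred M', ~ M' 1 & forall r, I r -> M' r].
    split.
    - split.
      + by exists 0, 0; rewrite mul0r addr0.
      + move=> _ _ [a [m [Mm ->]]] [b [k [Mk ->]]]; exists (a + b), (m + k).
        by split; [apply: MD | rewrite mulrDl addrACA].
      + move=> c _ [a [m [Mm ->]]]; exists (c * a), (c * m).
        by split; [apply: MM | rewrite mulrDr mulrA].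
    - case=> a [m [Mm E]]; apply: ninv; exists a.
      by rewrite SE; apply/boolp.asboolP; rewrite E addrAC subrr add0r.
    - by move=> r Ir; exists 0, r; rewrite mul0r add0r; split=> //; exact: (IM r Ir).
  have MM' : boolp.asbool (forall r, M r -> M' r).
    by apply/boolp.asboolP => r /= Mr; exists 0, r; rewrite mul0r add0r.
  have /boolp.asboolP/(_ x) := maxM (exist _ M' PM') MM'; apply.
  by exists 1, 0; rewrite mul1r addr0.
have idS : idealr_closed S.
  split; rewrite ?SE; [exact/boolp.asboolP | exact/boolp.asboolP |].
  move=> a u v; rewrite !SE => /boolp.asboolP Mu /boolp.asboolP Mv.
  by apply/boolp.asboolP; apply: MD => //; apply: MM.
have prS : prime_idealr_closed S.
  move=> u v; rewrite !SE => /boolp.asboolP Muv; apply/orP.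
  have [Su|nSu] := boolP (S u); [by left | right].
  have [y] := inv u nSu; rewrite SE => /boolp.asboolP My.
  apply/boolp.asboolP; rewrite -[v](subrK (y * (u * v))).
  by apply: MD; [rewrite mulrA -{1}[v]mul1r -mulrBl mulrC; apply: MM | apply: MM].
by exists (pack_prime idS prS) => [x|r /IM Mr]; [apply: inv | apply/boolp.asboolP].
Qed.

Lemma unit_of_primes (R : comNzRingType) (x : R) :
  (forall q : prime_idealr R, x \notin q) -> exists y, y * x = 1.
Proof.
move=> xq; apply: boolp.contrapT => nx.
have [||q _ /(_ x)] := @exists_maximal_prime R (fun r => exists y, y * x = r).
- split.
  + by exists 0; rewrite mul0r.
  + by move=> _ _ [y <-] [z <-]; exists (y + z); rewrite mulrDl.
  + by move=> a _ [y <-]; exists (a * y); rewrite mulrA.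
- exact: nx.
- by move=> qx; have := xq q; rewrite qx //; exists 1; rewrite mul1r.
Qed.

Lemma gen_ideal_pred (R : comNzRingType) t (f : 'I_t -> R) :
  ideal_pred (gen_ideal f).
Proof.
split.
- by exists (fun=> 0); rewrite big1 // => i _; rewrite mul0r.
- move=> _ _ [c ->] [d ->]; exists (fun i => c i + d i).
  by rewrite -big_split; apply: eq_bigr => i _; rewrite mulrDl.
- move=> a _ [c ->]; exists (fun i => a * c i).
  by rewrite big_distrr; apply: eq_bigr => i _; rewrite /= mulrA.
Qed.

Lemma gen_ideal_gen (R : comNzRingType) t (f : 'I_t -> R) i : gen_ideal f (f i).
Proof.
exists (fun j => (j == i)%:R); rewrite (bigD1 i) //= eqxx mul1r big1 ?addr0 //.
by move=> j /negbTE->; rewrite mul0r.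
Qed.

Lemma gen_ideal_sub (R : comNzRingType) t (f : 'I_t -> R) (p : prime_idealr R) :
  (forall i, f i \in p) -> forall r, gen_ideal f r -> r \in p.
Proof. by move=> fp _ [c ->]; apply: rpred_sum => i _; apply: idealMr. Qed.

Lemma jac_ideal_pred (R : comNzRingType) n (F : 'I_n -> {mpoly R[n]}) :
  ideal_pred (jac_ideal F).
Proof.
have [I0 ID IM] := gen_ideal_pred F.
split.
- by exists 0, 0; rewrite mul0r addr0.
- move=> _ _ [q [g [Iq ->]]] [q' [g' [Iq' ->]]]; exists (q + q'), (g + g').
  by split; [apply: ID | rewrite mulrDl addrACA].
- move=> a _ [q [g [Iq ->]]]; exists (a * q), (a * g).
  by split; [apply: IM | rewrite mulrDr mulrA].
Qed.

(** * Residue fields *)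

Lemma fractionP (D : idomainType) (x : {fraction D}) : exists a b,
  b != 0 /\ x = FracField.tofrac a / FracField.tofrac b.
Proof.
elim/quotW: x => r; exists \n_r, \d_r; split; first exact: denom_ratioP.
have nz : FracField.tofrac \d_r != 0 by rewrite tofrac_eq0 denom_ratioP.
apply: (mulIf nz); rewrite divfK //; unlock FracField.tofrac.
rewrite -[LHS]FracField.pi_mul; apply/eqmodP; rewrite /= FracField.equivfE.
rewrite !numden_Ratio ?(oner_neq0, mulf_neq0, denom_ratioP) //.
by rewrite !mulr1 mulrC.
Qed.

Section ResidueMorphism.
Variables (R : comNzRingType) (p : prime_idealr R).

Fact to_residue_field_is_zmod : zmod_morphism (@to_residue_field R p).
Proof.
by move=> x y; rewrite /to_residue_field -rmorphB /= -[in RHS]rmorphB.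
Qed.

Fact to_residue_field_is_monoid : monoid_morphism (@to_residue_field R p).
Proof.
split; first by rewrite /to_residue_field (rmorph1 \pi_{ideal_quot p}%qT) rmorph1.
move=> x y; rewrite /to_residue_field -[in RHS]rmorphM; congr (FracField.tofrac _).
exact: (rmorphM (\pi_{ideal_quot p}%qT)).
Qed.

HB.instance Definition _ := GRing.isZmodMorphism.Build R (residue_field p)
  (@to_residue_field R p) to_residue_field_is_zmod.
HB.instance Definition _ := GRing.isMonoidMorphism.Build R (residue_field p)
  (@to_residue_field R p) to_residue_field_is_monoid.

Lemma to_residue_field_eq0 r : (to_residue_field p r == 0) = (r \in p).
Proof.
rewrite /to_residue_field tofrac_eq0 -[r in RHS]subr0.
by rewrite Quotient.idealrBE (rmorph0 \pi_{ideal_quot p}%qT).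
Qed.

Lemma residue_fieldP (x : residue_field p) : exists a b,
  b \notin p /\ x = to_residue_field p a / to_residue_field p b.
Proof.
have [c [d [nz ->]]] := fractionP x.
have lift (y : residue_domain p) : exists a, y = \pi_({ideal_quot p})%qT a.
  by exists (repr (y : {ideal_quot p})); rewrite reprK.
have [[a Ec] [b Ed]] := (lift c, lift d).
exists a, b; split; last by rewrite /to_residue_field -Ec -Ed.
by rewrite -to_residue_field_eq0 /to_residue_field -Ed tofrac_eq0.
Qed.

Lemma maximal_residue_fieldP : maximal_prime p ->
  forall x : residue_field p, exists a, x = to_residue_field p a.
Proof.
move=> maxp x; have [a [b [bp ->]]] := residue_fieldP x.
have [y] := maxp b bp; rewrite -to_residue_field_eq0 rmorphB rmorph1 rmorphM /=.
rewrite subr_eq0 => /eqP E; exists (a * y); rewrite rmorphM /=.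
have nz : to_residue_field p b != 0 by rewrite to_residue_field_eq0.
by congr (_ * _); apply: (mulIf nz); rewrite mulVf // -E.
Qed.

End ResidueMorphism.

(** * Evaluation and Taylor expansion of polynomials *)

Lemma mpoly_ring_ind (R : comNzRingType) n (P : {mpoly R[n]} -> Prop) :
  (forall c, P c%:MP) -> (forall i, P 'X_i) ->
  (forall p q, P p -> P q -> P (p + q)) ->
  (forall p q, P p -> P q -> P (p * q)) -> forall p, P p.
Proof.
move=> PC PX PD PM p; elim/mpolyind: p => [|c m p _ _ IHp]; first exact: (PC 0).
apply: (PD) => //; rewrite -mul_mpolyC; apply: (PM) => //.
rewrite mpolyXE_id; elim/big_rec: _ => [|i q _ Pq]; first exact: (PC 1).
by apply: (PM) => //; elim: (m i) => [|k IHk]; [exact: (PC 1) | rewrite exprS; exact: PM].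
Qed.

Lemma mmap_map_mpoly (R S T : comNzRingType) (g : {rmorphism R -> S})
    (h : {rmorphism S -> T}) n (b : 'I_n -> T) p :
  mmap h b (map_mpoly g p) = mmap (h \o g) b p.
Proof.
elim/mpoly_ring_ind: p => [c|i|p q IHp IHq|p q IHp IHq].
- by rewrite map_mpolyC !mmapC.
- by rewrite map_mpolyX !mmapX.
- by rewrite !rmorphD /= IHp IHq.
- by rewrite !rmorphM /= IHp IHq.
Qed.

Lemma meval_map_mpoly (R S : comNzRingType) (g : {rmorphism R -> S}) n
    (b : 'I_n -> S) p : (map_mpoly g p).@[b] = mmap g b p.
Proof. by rewrite /meval mmap_map_mpoly. Qed.

Lemma rmorph_mmap (R S T : comNzRingType) (g : {rmorphism R -> S})
    (h : {rmorphism S -> T}) n (b : 'I_n -> S) p :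
  h (mmap g b p) = mmap (h \o g) (h \o b) p.
Proof.
elim/mpoly_ring_ind: p => [c|i|p q IHp IHq|p q IHp IHq].
- by rewrite !mmapC.
- by rewrite !mmapX !mmap1U.
- by rewrite !rmorphD /= IHp IHq.
- by rewrite !rmorphM /= IHp IHq.
Qed.

Lemma mderiv_map_mpoly (R S : comNzRingType) (g : {rmorphism R -> S}) n i
    (p : {mpoly R[n]}) : (map_mpoly g p)^`M(i) = map_mpoly g p^`M(i).
Proof.
elim/mpoly_ring_ind: p => [c|j|p q IHp IHq|p q IHp IHq].
- by rewrite map_mpolyC !mderivC raddf0.
- by rewrite map_mpolyX !mderivX map_mpolyZ map_mpolyX rmorph_nat.
- by rewrite mderivD !rmorphD /= mderivD IHp IHq.
- by rewrite mderivM rmorphM /= mderivM rmorphD !rmorphM /= IHp IHq.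
Qed.

Lemma jacobian_map (R S : comNzRingType) (g : {rmorphism R -> S}) n
    (F : 'I_n -> {mpoly R[n]}) :
  jacobian (specialize g F) = map_mpoly g (jacobian F).
Proof.
rewrite /jacobian -det_map_mx; congr (\det _).
by apply/matrixP => i j; rewrite !mxE mderiv_map_mpoly.
Qed.

(** Hadamard's lemma: the difference quotients of a polynomial at a point can be
    chosen so that their values at this point are the partial derivatives. *)
Lemma hadamard (R : comNzRingType) n (x : 'I_n -> R) (p : {mpoly R[n]}) :
  exists2 g : 'I_n -> {mpoly R[n]},
    p - (p.@[x])%:MP = \sum_j g j * ('X_j - (x j)%:MP) &
    forall j, (g j).@[x] = (p^`M(j)).@[x].
Proof.
elim/mpoly_ring_ind: p => [c|i|p q [g Eg g'] [h Eh h']|p q [g Eg g'] [h Eh h']].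
- exists (fun=> 0); last by move=> j; rewrite mderivC.
  by rewrite mevalC subrr big1 // => j _; rewrite mul0r.
- exists (fun j => (j == i)%:R).
    rewrite mevalXU (bigD1 i) //= eqxx mul1r big1 ?addr0 // => j /negbTE->.
    by rewrite mul0r.
  move=> j; rewrite mderivX mevalZ rmorph_nat mnmE eq_sym.
  case: eqP => [->|_]; last by rewrite mul0r.
  have -> : (U_(j) - U_(j))%MM = 0%MM :> 'X_{1..n}.
    by apply/mnmP => k; rewrite mnmBE subnn mnm0E.
  by rewrite mul1r mpolyX0 meval1.
- exists (fun j => g j + h j).
    rewrite mevalD mpolyCD opprD addrACA Eg Eh -big_split.
    by apply: eq_bigr => j _; rewrite mulrDl.
  by move=> j; rewrite mderivD !mevalD g' h'.
- exists (fun j => g j * q + (p.@[x])%:MP * h j).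
    rewrite mevalM mpolyCM.
    have -> : p * q - (p.@[x])%:MP * (q.@[x])%:MP =
      (p - (p.@[x])%:MP) * q + (p.@[x])%:MP * (q - (q.@[x])%:MP).
      by rewrite mulrBl mulrBr addrA subrK.
    rewrite Eg Eh mulr_suml mulr_sumr -big_split.
    by apply: eq_bigr => j _; rewrite /= mulrDl mulrAC mulrA.
  by move=> j; rewrite mderivM !mevalD !mevalM mevalC g' h'.
Qed.

Lemma meval_jacobian (R : comNzRingType) n (F : 'I_n -> {mpoly R[n]}) x :
  (jacobian F).@[x] = \det (\matrix_(i, j) ((F i)^`M(j)).@[x]).
Proof.
rewrite /jacobian -det_map_mx; congr (\det _).
by apply/matrixP => i j; rewrite !mxE.
Qed.

Lemma mmap_jacobian (R S : comNzRingType) (g : {rmorphism R -> S}) n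
    (F : 'I_n -> {mpoly R[n]}) x :
  mmap g x (jacobian F) = \det (\matrix_(i, j) mmap g x (F i)^`M(j)).
Proof.
rewrite /jacobian -det_map_mx; congr (\det _).
by apply/matrixP => i j; rewrite !mxE.
Qed.

(** The remainder is quadratic in [e] because Hadamard's lemma applies again to
    the difference quotients that it yields. *)
Lemma taylor2 (R S : comNzRingType) (phi : {rmorphism R -> S}) n
    (x e : 'I_n -> S) (p : {mpoly R[n]}) :
  exists h : 'I_n -> 'I_n -> S,
    mmap phi (fun j => x j + e j) p =
      mmap phi x p + \sum_j mmap phi x p^`M(j) * e j
      + \sum_j \sum_k h j k * (e k * e j).
Proof.
have [g Eg g'] := hadamard x (map_mpoly phi p).
pose y j := x j + e j.
have diff q (k : 'I_n -> {mpoly S[n]}) :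
    q - (q.@[x])%:MP = \sum_j k j * ('X_j - (x j)%:MP) ->
    q.@[y] = q.@[x] + \sum_j (k j).@[y] * e j.
  move=> /(congr1 (meval y)); rewrite mevalB mevalC => /eqP.
  rewrite subr_eq addrC => /eqP ->; congr (_ + _).
  rewrite raddf_sum; apply: eq_bigr => j _ /=.
  by rewrite mevalM mevalB mevalXU mevalC /y addrAC subrr add0r.
have /fin_all_exists [h Eh] j : exists h : 'I_n -> S,
    (g j).@[y] = (g j).@[x] + \sum_k h k * e k.
  by have [k Ek _] := hadamard x (g j); exists (fun l => (k l).@[y]); apply: diff.
exists h; rewrite -!meval_map_mpoly (diff _ _ Eg) -addrA; congr (_ + _).
rewrite -big_split; apply: eq_bigr => j _ /=.
rewrite Eh mulrDl g' mderiv_map_mpoly meval_map_mpoly; congr (_ + _).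
by rewrite mulr_suml; apply: eq_bigr => k _; rewrite mulrA.
Qed.

(** * Lifting solutions *)

Lemma gen_ideal_map (R S : comNzRingType) (g : {rmorphism R -> S}) t
    (f : 'I_t -> R) r : gen_ideal f r -> gen_ideal (g \o f) (g r).
Proof.
case=> c ->; exists (g \o c); rewrite rmorph_sum.
by apply: eq_bigr => i _; rewrite rmorphM.
Qed.

Lemma elim_ideal_map (R S : comNzRingType) (g : {rmorphism R -> S}) n
    (F : 'I_n -> {mpoly R[n]}) h :
  elim_ideal F h -> elim_ideal (specialize g F) (g h).
Proof.
case=> [q [a [/(gen_ideal_map (map_mpoly g)) Iq E]]].
exists (map_mpoly g q), (map_mpoly g a); split=> //.
by rewrite jacobian_map -rmorphM -rmorphD -E /= map_mpolyC.
Qed.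

Lemma preim_prime (R S : comNzRingType) (g : {rmorphism R -> S})
  (q : prime_idealr S) : exists p : prime_idealr R, forall r, (r \in p) = (g r \in q).
Proof.
pose P : R -> bool := fun r => g r \in q.
have idP : idealr_closed P.
  split; rewrite ?[_ \in P]/(P _) /P ?rmorph0 ?rmorph1 ?rpred0 ?idealr1 //.
  move=> a u v; rewrite ![_ \in P]/(P _) /P rmorphD rmorphM => gu gv.
  by apply: rpredD => //; apply: idealMr.
have prP : prime_idealr_closed P.
  by move=> u v; rewrite ![_ \in P]/(P _) /P rmorphM /= prime_idealrM.
by exists (pack_prime idP prP).
Qed.

(** The corrected solution is [b - J^-1 F(b)], where the inverse of the Jacobian
    matrix [J] at [b] is [y] times its adjugate; the quadratic remainder of the
    Taylor expansion vanishes as [N] has square zero. *)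
Lemma newton_lift (R B : comNzRingType) (phi : {rmorphism R -> B}) n
    (F : 'I_n -> {mpoly R[n]}) (N : B -> Prop) (b : 'I_n -> B) y :
  square_zero_ideal N -> (forall i, N (mmap phi b (F i))) ->
  y * mmap phi b (jacobian F) = 1 ->
  exists2 b' : 'I_n -> B,
    forall j, N (b' j - b j) & forall i, mmap phi b' (F i) = 0.
Proof.
move=> [N0 ND NM NN] NF; rewrite mmap_jacobian.
set J := \matrix_(i, j) _ => yD.
pose w : 'cV[B]_n := \col_i mmap phi b (F i).
pose v := (- y) *: (\adj J *m w).
have Jv : J *m v = - w.
  by rewrite -scalemxAr mulmxA mul_mx_adj mul_scalar_mx scalerA mulNr yD scaleN1r.
have Nv j : N (v j 0).
  rewrite mxE; apply: (NM); rewrite mxE; elim/big_ind: _ => // i _.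
  by apply: NM; rewrite mxE.
exists (fun j => b j + v j 0) => [j|i]; first by rewrite addrAC subrr add0r.
have [h ->] := taylor2 phi b (v^~ 0) (F i).
rewrite [X in _ + X]big1 => [|j _]; last first.
  by rewrite big1 // => k _; rewrite (NN _ _ (Nv k) (Nv j)) mulr0.
have -> : \sum_j mmap phi b (F i)^`M(j) * v j 0 = (J *m v) i 0.
  by rewrite [RHS]mxE; apply: eq_bigr => j _; rewrite [J _ _]mxE.
by rewrite Jv !mxE addr0 subrr.
Qed.

(** Every prime avoids [phi h], which is therefore a unit. At a solution modulo
    [N] the relation [h = q + g * D] reads [phi h = nu + g(b) D(b)] with
    [nu] in [N]; as [nu] is nilpotent, [D(b)] is a unit. *)
Lemma smooth_above_elim (R : comNzRingType) n (F : 'I_n -> {mpoly R[n]})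
    (U : prime_idealr R -> Prop) h :
  elim_ideal F h -> (forall p, U p -> h \notin p) -> smooth_above U F.
Proof.
move=> [_ [g [[c ->] E]]] Uh B phi phiU N sqN b NF; have [N0 ND NM NN] := sqN.
have [z zh] : exists z, z * phi h = 1.
  apply: unit_of_primes => q; have [p pq] := preim_prime phi q.
  by rewrite -pq; apply: Uh; apply: phiU pq.
pose nu := \sum_i mmap phi b (c i) * mmap phi b (F i).
have Nnu : N nu by rewrite /nu; elim/big_ind: _ => // i _; apply: NM.
have nu2 : nu * nu = 0 by apply: NN.
have hE : phi h = nu + mmap phi b g * mmap phi b (jacobian F).
  have /= := congr1 (mmap phi b) E; rewrite mmapC => ->.
  rewrite rmorphD rmorphM rmorph_sum /=; congr (_ + _).
  by apply: eq_bigr => i _; rewrite rmorphM.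
apply: (newton_lift (y := (1 + z * nu) * (z * mmap phi b g)) sqN NF).
have zgD : z * mmap phi b g * mmap phi b (jacobian F) = 1 - z * nu.
  by rewrite -zh hE mulrDr mulrA addrAC subrr add0r.
rewrite -mulrA zgD mulrDl mul1r mulrBr mulr1 mulrACA nu2 mulr0 subr0.
by rewrite subrK.
Qed.

(** The lifting property of smoothness for the surjection [B/J -> B/N], expressed
    with representatives in [B]. *)
Lemma smooth_lift_mod (R : comNzRingType) n t (F : 'I_t -> {mpoly R[n]}) :
  smooth F -> forall (B : comNzRingType) (phi : {rmorphism R -> B})
    (J : idealr B) (N : B -> Prop), ideal_pred N ->
    (forall u v, N u -> N v -> u * v \in J) ->
  forall b : 'I_n -> B, (forall i, N (mmap phi b (F i))) ->
  exists2 b' : 'I_n -> B,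
    forall j, N (b' j - b j) & forall i, mmap phi b' (F i) \in J.
Proof.
move=> smF B phi J N [N0 ND NM] NN b NF.
pose pi : {rmorphism B -> {ideal_quot J}} := \pi_{ideal_quot J}%qT.
have pi0 r : (pi r == 0) = (r \in J).
  by rewrite -[r in RHS]subr0 Quotient.idealrBE -(rmorph0 pi).
pose N' x := exists2 u, N u & x = pi u.
have sqN : square_zero_ideal N'.
  split.
  - by exists 0; rewrite ?rmorph0.
  - by move=> _ _ [u Nu ->] [v Nv ->]; exists (u + v); [apply: ND | rewrite rmorphD].
  - move=> x _ [u Nu ->]; have [y ->] : exists y, x = pi y.
      by exists (repr x); rewrite /pi /= reprK.
    by exists (y * u); [apply: NM | rewrite rmorphM].
  - by move=> _ _ [u Nu ->] [v Nv ->]; apply/eqP; rewrite -rmorphM pi0; apply: NN.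
have [i|b1 Nb1 Fb1] := smF _ (pi \o phi) (fun _ _ _ => I) _ sqN (pi \o b).
  by exists (mmap phi b (F i)); [exact: NF | rewrite rmorph_mmap].
have /fin_all_exists2 [e Ne Ee] j : exists2 e, N e & b1 j - pi (b j) = pi e by apply: Nb1.
have b1E : b1 = pi \o (fun j => b j + e j).
  by apply: boolp.funext => j /=; rewrite rmorphD /= -Ee addrC subrK.
exists (fun j => b j + e j) => [j|i]; first by rewrite addrAC subrr add0r.
by rewrite -pi0 rmorph_mmap -b1E Fb1.
Qed.

(** * Flatness of scalar extensions of a field *)

Section Flatness.
Variables (L : fieldType) (C : comNzRingType) (iota : {rmorphism L -> C}).

Definition lin_free d (e : 'I_d -> C) : Prop :=
  forall u : 'I_d -> L, \sum_k iota (u k) * e k = 0 -> forall k, u k = 0.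

(** Elimination of one generator at a time, as long as there is a relation. *)
Lemma extract_lin_free d (e : 'I_d -> C) (T : Type) (c : T -> C)
    (a : T -> 'I_d -> L) : (forall t, c t = \sum_k iota (a t k) * e k) ->
  exists d' (e' : 'I_d' -> C) (a' : T -> 'I_d' -> L),
    lin_free e' /\ forall t, c t = \sum_k iota (a' t k) * e' k.
Proof.
elim: d e a => [|d IHd] e a Ec; first by exists 0, e, a; split=> // u _ [].
have [fe|nfe] := boolp.pselect (lin_free e); first by exists d.+1, e, a.
have [u [rel [k0 uk0]]] : exists u : 'I_d.+1 -> L,
    \sum_k iota (u k) * e k = 0 /\ exists k, u k != 0.
  apply: boolp.contrapT => nu; apply: nfe => u rel k.
  by apply/eqP; apply: boolp.contrapT => /negP uk; apply: nu; exists u; split=> //; exists k.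
pose w k := - (u k0)^-1 * u (lift k0 k).
have ek0 : e k0 = \sum_k iota (w k) * e (lift k0 k).
  have : iota (u k0)^-1 * (\sum_k iota (u k) * e k) = 0 by rewrite rel mulr0.
  rewrite (bigD1_ord k0) //= mulrDr mulrA -rmorphM mulVf // rmorph1 mul1r.
  move/eqP; rewrite addr_eq0 => /eqP ->; rewrite mulr_sumr -sumrN.
  by apply: eq_bigr => k _; rewrite /w mulNr rmorphN rmorphM mulNr mulrA.
apply: (IHd (fun k => e (lift k0 k)) (fun t k => a t k0 * w k + a t (lift k0 k))).
move=> t; rewrite Ec (bigD1_ord k0) //= ek0 mulr_sumr -big_split.
by apply: eq_bigr => k _ /=; rewrite rmorphD mulrDl rmorphM mulrA.
Qed.

Lemma lin_free_coefs n (T : finType) (q : T -> {mpoly C[n]}) :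
  exists d (e : 'I_d -> C) (s : T -> 'I_d -> {mpoly L[n]}),
    lin_free e /\ forall t, q t = \sum_k (e k)%:MP * map_mpoly iota (s t k).
Proof.
pose K := \max_t msize (q t).
pose c (tm : T * 'X_{1..n < K}) := (q tm.1)@_tm.2.
have [] := @extract_lin_free _ (fun i : 'I_#|{: T * 'X_{1..n < K}}| => c (enum_val i))
  _ c (fun tm i => (i == enum_rank tm)%:R).
  move=> tm; rewrite (bigD1 (enum_rank tm)) //= eqxx rmorph1 mul1r enum_rankK.
  by rewrite big1 ?addr0 // => i /negbTE->; rewrite rmorph0 mul0r.
move=> d [e [a [fe Ec]]].
exists d, e, (fun t k => \sum_(m : 'X_{1..n < K}) a (t, m) k *: 'X_[m]).
split=> // t; rewrite [LHS](@mpolywE _ _ K); last exact: leq_bigmax.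
under [RHS]eq_bigr do rewrite raddf_sum mulr_sumr.
rewrite exchange_big; apply: eq_bigr => m _ /=.
rewrite [_@__](Ec (t, m)) scaler_suml; apply: eq_bigr => k _.
by rewrite map_mpolyZ map_mpolyX mul_mpolyC scalerA mulrC.
Qed.

Lemma lin_free_mpoly n d (e : 'I_d -> C) (s : 'I_d -> {mpoly L[n]}) :
  lin_free e -> \sum_k (e k)%:MP * map_mpoly iota (s k) = 0 -> forall k, s k = 0.
Proof.
move=> fe E k; apply/mpolyP => m; rewrite mcoeff0.
apply: (fe (fun k => (s k)@_m)); have := congr1 (mcoeff m) E.
rewrite mcoeff0 raddf_sum /= => E'; rewrite -[RHS]E'.
by apply: eq_bigr => i _; rewrite mcoeffCM mcoeff_map_mpoly mulrC.
Qed.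

(** Flatness of [C] over the field [L]: a polynomial outside the prime [P] stays
    a nonzerodivisor modulo the extension of [P]. Comparing coefficients on an
    [L]-free family reduces this to the primality of [P]. *)
Lemma prime_ext_nonzerodivisor n t (P : prime_idealr {mpoly L[n]})
    (F : 'I_t -> {mpoly L[n]}) r (s : {mpoly C[n]}) (c : 'I_t -> {mpoly C[n]}) :
  (forall i, F i \in P) -> r \notin P ->
  map_mpoly iota r * s = \sum_i c i * map_mpoly iota (F i) ->
  exists d (e : 'I_d -> C) (s' : 'I_d -> {mpoly L[n]}),
    (forall k, s' k \in P) /\ s = \sum_k (e k)%:MP * map_mpoly iota (s' k).
Proof.
move=> FP rP E.
have [d [e [a [fe Ea]]]] := lin_free_coefs (fun o => if o is Some i then c i else s).
exists d, e, (a None); split; last exact: (Ea None).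
move=> k; have := rP; apply: contraR => skP.
suff : r * a None k \in P by rewrite prime_idealrM (negbTE skP) orbF.
suff : r * a None k - \sum_i a (Some i) k * F i = 0.
  by move/eqP; rewrite subr_eq0 => /eqP ->; apply: rpred_sum => i _; apply: idealMr.
apply: (lin_free_mpoly (s := fun k => r * a None k - \sum_i a (Some i) k * F i) fe).
move/eqP: E; rewrite -subr_eq0 => /eqP E; rewrite -[RHS]E.
rewrite (Ea None) mulr_sumr; under [X in _ - X]eq_bigr do rewrite (Ea (Some _)) mulr_suml.
rewrite exchange_big -sumrB /=; apply: eq_bigr => l _.
rewrite rmorphB rmorphM /= mulrBr mulrCA; congr (_ - _).
by rewrite rmorph_sum mulr_sumr; apply: eq_bigr => i _; rewrite rmorphM mulrA.
Qed.

End Flatness.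

(** * Dimension zero where the Jacobian determinant is invertible *)

(** A morphism [g] from [R[x]] is evaluation at the point of coordinates
    [g X_j]. *)
Lemma mmap_generic_point (R C : comNzRingType) n (g : {rmorphism {mpoly R[n]} -> C}) p :
  mmap (g \o @mpolyC n R) (fun j => g 'X_j) p = g p.
Proof.
elim/mpoly_ring_ind: p => [c|i|p q IHp IHq|p q IHp IHq].
- by rewrite mmapC.
- by rewrite mmapX mmap1U.
- by rewrite !rmorphD /= IHp IHq.
- by rewrite !rmorphM /= IHp IHq.
Qed.

(** Geometrically, [pi] is a point [xi] of the zero set of [P] with values in [C],
    and it is isolated among the solutions of [F] since the Jacobian determinant
    does not vanish there. So [P] has no room to be smaller than the ideal of
    [xi]. *)
Lemma kernel_sub_prime (L : fieldType) (C : comNzRingType) n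
    (pi : {rmorphism {mpoly L[n]} -> C}) (F : 'I_n -> {mpoly L[n]})
    (P : prime_idealr {mpoly L[n]}) :
  (forall i, F i \in P) -> (forall p, p \in P -> pi p = 0) ->
  pi (jacobian F) != 0 -> forall r, pi r = 0 -> r \in P.
Proof.
move=> FP PQ DQ r rQ; apply: contraR DQ => rP.
pose iota : {rmorphism _ -> _} := pi \o @mpolyC n L.
pose xi j := pi 'X_j.
have ev p : (map_mpoly iota p).@[xi] = pi p.
  by rewrite meval_map_mpoly mmap_generic_point.
have had p : exists g : 'I_n -> {mpoly C[n]}, pi p = 0 ->
    map_mpoly iota p = \sum_j g j * ('X_j - (xi j)%:MP) /\
    forall j, (g j).@[xi] = (map_mpoly iota p^`M(j)).@[xi].
  have [g Eg g'] := hadamard xi (map_mpoly iota p).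
  exists g => p0; rewrite -Eg ev p0 mpolyC0 subr0; split=> // j.
  by rewrite g' mderiv_map_mpoly.
have [R /(_ rQ)[ER _]] := had r.
have /fin_all_exists[g Eg] i := had (F i).
pose G := \matrix_(i, j) g i j.
pose X : 'cV_n := \col_j ('X_j - (xi j)%:MP).
pose Fi : 'cV_n := \col_i map_mpoly iota (F i).
have GX : G *m X = Fi.
  apply/colP => i; rewrite !mxE; have [-> _] := Eg i (PQ _ (FP i)).
  by apply: eq_bigr => j _; rewrite !mxE.
(* Cramer's rule: [det G] times the column [X] is in the ideal of the [F i]. *)
have Er : map_mpoly iota r * \det G =
    \sum_i (\row_j R j *m \adj G) 0 i * map_mpoly iota (F i).
  transitivity ((\row_j R j *m \adj G *m Fi) 0 0); last first.
    by rewrite mxE; apply: eq_bigr => i _; rewrite [Fi _ _]mxE.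
  rewrite -GX -mulmxA [_ *m (G *m X)]mulmxA mul_adj_mx mul_scalar_mx -scalemxAr mxE.
  rewrite mulrC ER; congr (_ * _); rewrite mxE.
  by apply: eq_bigr => j _; rewrite !mxE.
have [d [e [s [sP Es]]]] := prime_ext_nonzerodivisor FP rP Er.
have : (\det G).@[xi] = 0.
  rewrite Es raddf_sum big1 // => k _ /=.
  by rewrite rmorphM /= ev PQ ?mulr0.
rewrite -ev -jacobian_map meval_jacobian => <-.
rewrite -det_map_mx; apply/eqP; congr (\det _); apply/matrixP => i j; rewrite !mxE.
by have [_ g'] := Eg i (PQ _ (FP i)); rewrite /= g' mderiv_map_mpoly.
Qed.

Lemma primes_incomparable (L : fieldType) n (F : 'I_n -> {mpoly L[n]})
    (P Q : prime_idealr {mpoly L[n]}) :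
  (forall i, F i \in P) -> {subset P <= Q} -> jacobian F \notin Q ->
  {subset Q <= P}.
Proof.
have Q0 p : (p \in Q) = (to_residue_field Q p == 0) by rewrite to_residue_field_eq0.
move=> FP PQ; rewrite Q0 => DQ r; rewrite Q0 => /eqP.
apply: (kernel_sub_prime FP) => // p /PQ; rewrite Q0.
by move/eqP.
Qed.

Lemma field_ideal_proper (L : fieldType) (q : prime_idealr L) c : c != 0 -> c \notin q.
Proof.
move=> nz; apply: contraFN (idealr1 q) => cq.
by rewrite -(mulVf nz); apply: idealMr.
Qed.

Lemma const_notin_prime (L : fieldType) n (q : prime_idealr {mpoly L[n]}) c :
  c != 0 -> c%:MP \notin q.
Proof.
move=> nz; apply: contraFN (idealr1 q) => cq.
by rewrite -mpolyC1 -(mulVf nz) mpolyCM; apply: idealMr.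
Qed.

Lemma elim_jacobian_notin (L : fieldType) n (F : 'I_n -> {mpoly L[n]}) c
    (Q : prime_idealr {mpoly L[n]}) :
  elim_ideal F c -> c != 0 -> (forall i, F i \in Q) -> jacobian F \notin Q.
Proof.
move=> [q [g [Iq E]]] nz FQ; apply: contraNN (const_notin_prime Q nz) => DQ.
by rewrite E; apply: rpredD; [apply: gen_ideal_sub Iq | apply: idealMr].
Qed.

Lemma zero_dim_elim (L : fieldType) n (F : 'I_n -> {mpoly L[n]}) c :
  elim_ideal F c -> c != 0 -> ~ gen_ideal F 1 -> zero_dim_ci F.
Proof.
move=> Fc nz F1; exists 0 => //; split.
  have [p _ Fp] := exists_maximal_prime (gen_ideal_pred F) F1.
  by exists (fun=> p); split.
move=> [P [IP /(_ 0 isT)[P01 nP10]]]; apply: nP10.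
have FP j i : (i <= 1)%N -> F j \in P i by move=> /IP; apply; apply: gen_ideal_gen.
apply: (primes_incomparable (F := F)) => // [i|]; first exact: FP.
by apply: elim_jacobian_notin Fc nz _ => i; apply: FP.
Qed.

(** * The open set where an element of the elimination ideal is nonzero *)

Lemma zero_prime (R : idomainType) :
  exists p : prime_idealr R, forall r, (r \in p) = (r == 0).
Proof.
pose P : R -> bool := fun r => r == 0.
have PE r : (r \in P) = (r == 0) by [].
have idP : idealr_closed P.
  split; rewrite ?PE ?eqxx ?oner_eq0 // => a u v.
  by rewrite !PE => /eqP -> /eqP ->; rewrite mulr0 addr0.
have prP : prime_idealr_closed P by move=> u v; rewrite !PE mulf_eq0.
by exists (pack_prime idP prP).
Qed.

Lemma elim_fiber (R : comNzRingType) n (F : 'I_n -> {mpoly R[n]}) h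
    (p : prime_idealr R) :
  elim_ideal F h -> h \notin p ->
  elim_ideal (fiber F p) (to_residue_field p h) /\ to_residue_field p h != 0.
Proof.
by move=> Fh hp; split; [apply: elim_ideal_map | rewrite to_residue_field_eq0].
Qed.

Lemma basic_open_I_smooth (R : idomainType) n (F : 'I_n -> {mpoly R[n]}) h :
  h != 0 -> elim_ideal F h -> I_smooth F (basic_open h).
Proof.
move=> nz Fh; split.
- by exists (eq h) => p; split=> [hp|[_ <-]//]; exists h.
- move=> V [E VE] [p /VE[r Er rp]]; have [q q0] := zero_prime R; exists q.
  rewrite /basic_open q0 nz; split=> //; apply/VE; exists r => //; rewrite q0.
  by apply: contraNneq rp => ->; apply: rpred0.
- exact: smooth_above_elim Fh _.
- move=> p hp fib1; have [Fph nzp] := elim_fiber Fh hp; split.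
  + exact: zero_dim_elim Fph nzp fib1.
  + by apply: smooth_above_elim Fph _ => q _; apply: field_ideal_proper.
Qed.

(** * Zariski's lemma *)

(** The coefficients may form any domain, as they will be taken in polynomial
    rings. *)
Definition algebraic_elt (R : nzRingType) (k : fieldType) (iota : R -> k) u :=
  exists2 p : {poly R}, p != 0 & root (map_poly iota p) u.

(** The negation says that some localization [R[1/f]] is a field. *)
Definition not_goldman (R : idomainType) : Prop :=
  forall f : R, f != 0 -> exists2 g, g != 0 & forall N q, q * g != f ^+ N.

(** For [g = 1 + X f], the polynomials [g] and [f] are coprime, so [g], which is
    not constant, divides no power of [f]. *)
Lemma poly_not_goldman (R : idomainType) : not_goldman {poly R}.
Proof.
move=> f nzf; pose g := 1 + 'X * f.
have szg : (1 < size g)%N.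
  rewrite /g addrC size_polyDl ?size_poly1 mulrC size_mulX // ltnS;
  by rewrite lt0n size_poly_eq0.
exists g => [|N q]; first by rewrite -size_poly_gt0 ltnW.
apply/eqP => E.
have [a [b Eab]] : exists a b, a * g + b * ('X * f) ^+ N = 1.
  elim: N {E} => [|N [a [b E]]]; first by exists 0, 1; rewrite mul0r add0r mul1r.
  exists (a * (g - 'X * f) + b * ('X * f) ^+ N), (- b).
  transitivity ((a * g + b * ('X * f) ^+ N) * (g - 'X * f)).
    by rewrite exprS; ring.
  by rewrite E mul1r /g addrK.
have : g * (a + b * 'X ^+ N * q) = 1.
  by rewrite -Eab exprMn -E; ring.
move/(congr1 (fun p : {poly R} => size p)); rewrite size_poly1 => /eqP.
by rewrite size_mul_eq1 => /andP[/eqP sg _]; rewrite sg in szg.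
Qed.

Section Adjoin.
Variable k : fieldType.

(** The elements of [s] are adjoined one at a time, as indeterminates, unless they
    are algebraic over the ring obtained so far: this builds a transcendence basis
    along with the polynomial ring that it generates. Either nothing was adjoined,
    or that ring is a polynomial ring over a domain. *)
Lemma adjoin_transcendentals (s : seq k) (R : idomainType) (iota : {rmorphism R -> k}) :
  injective iota ->
  exists (R' : idomainType) (iota' : {rmorphism R' -> k}),
    [/\ injective iota', forall u, u \in s -> algebraic_elt iota' u,
        forall r, exists r', iota' r' = iota r
      & (forall u, algebraic_elt iota' u -> algebraic_elt iota u) \/ not_goldman R'].
Proof.
move=> inj; elim: s => [|u s [R' [iota' [inj' alg ext dich]]]].
  by exists R, iota; split=> // [r|]; [exists r | left].
have [au|nau] := boolp.pselect (algebraic_elt iota' u).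
  by exists R', iota'; split=> // v; rewrite inE => /predU1P[->|/alg].
have cu : commr_rmorph iota' u by move=> r; apply: mulrC.
pose jota : {rmorphism {poly R'} -> k} := horner_morph cu.
have jE p : jota p = (map_poly iota' p).[u] by [].
exists {poly R'}, jota; split.
- apply: raddf_inj => p pu; apply/eqP; apply: boolp.contrapT => /negP nz.
  by apply: nau; exists p => //; apply/rootP; rewrite -jE; apply: pu.
- have jC r : jota r%:P = iota' r by rewrite jE map_polyC hornerC.
  move=> v; rewrite inE => /predU1P[->|/alg[p nz pv]].
    exists ('X - ('X)%:P); first by rewrite polyXsubC_eq0.
    by rewrite rmorphB /= map_polyX map_polyC /= jE map_polyX hornerX root_XsubC.
  exists (map_poly polyC p); first by rewrite map_poly_eq0_id0 ?polyC_eq0 // lead_coef_eq0.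
  rewrite -map_poly_comp; apply: etrans pv; congr (root _ _).
  exact: eq_map_poly.
- move=> r; have [r' <-] := ext r; exists r'%:P.
  by rewrite jE map_polyC hornerC.
- by right; apply: poly_not_goldman.
Qed.

Variables (R : idomainType) (iota : {rmorphism R -> k}).
Hypothesis inj : injective iota.

(** If [p] has degree [e + 1] and leading coefficient [c], then
    [c^e p(u)] is a monic polynomial in [c u]. *)
Lemma integral_scaled_root (p : {poly R}) u : p != 0 -> root (map_poly iota p) u ->
  integralOver iota (iota (lead_coef p) * u).
Proof.
move=> nz /rootP pu; set c := lead_coef p; pose d := (size p).-1.
have szp : size p = d.+1 by rewrite /d prednK // size_poly_gt0.
case Ed : d => [|e].
  move: pu; have /size_poly1P[a nza ->] : size p == 1%N by rewrite szp Ed.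
  by rewrite map_polyC hornerC => /eqP; rewrite -(rmorph0 iota) (inj_eq inj) (negbTE nza).
pose q := \poly_(i < e.+2) (if i == e.+1 then 1 else p`_i * c ^+ (e - i)).
have mq : q \is monic.
  by rewrite monicE lead_coef_poly // eqxx ?oner_eq0.
exists q => //; apply/rootP.
rewrite -[RHS](mulr0 (iota c ^+ e)) -pu !horner_coef.
rewrite size_map_poly_id0; last by rewrite (monicP mq) rmorph1 oner_eq0.
rewrite size_map_poly_id0; last by rewrite -(rmorph0 iota) (inj_eq inj) lead_coef_eq0.
rewrite szp Ed size_poly_eq ?eqxx ?oner_eq0 // mulr_sumr.
apply: eq_bigr => i _; rewrite !coef_map coef_poly ltn_ord /= exprMn.
case: eqP => [->|/eqP ne].
  rewrite rmorph1 mul1r exprSr -mulrA; congr (_ * (_ * _)).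
  by rewrite /c lead_coefE szp Ed.
have lei : (i <= e)%N by rewrite -ltnS ltn_neqAle ne -ltnS ltn_ord.
have -> : iota c ^+ e = iota c ^+ (e - i) * iota c ^+ i by rewrite -exprD subnK.
rewrite rmorphM rmorphXn; ring.
Qed.

(** If [f] is the product of leading coefficients of equations of the [x i], every
    element of the algebra generated by the [x i], which is the whole field by the
    second hypothesis, becomes integral after multiplication by a power of [f].
    For the inverse of [g], clearing denominators in the integral equation shows
    that [g] divides a power of [f]. *)
Lemma goldman_of_algebraic n (x : 'I_n -> k) : (forall i, algebraic_elt iota (x i)) ->
  (forall (P : k -> Prop), (forall r, P (iota r)) -> (forall i, P (x i)) ->
     (forall u v, P u -> P v -> P (u + v)) -> (forall u v, P u -> P v -> P (u * v)) ->
     forall u, P u) ->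
  ~ not_goldman R.
Proof.
move=> algx gen notG.
have /fin_all_exists2 [p nzp px] i := algx i.
pose f := \prod_i lead_coef (p i).
have nzf : f != 0 by apply/prodf_neq0 => i _; rewrite lead_coef_eq0.
have [g nzg ng] := notG f nzf.
pose P u := exists N, integralOver iota (iota f ^+ N * u).
have [|i|u v [N uN] [N' vN]|u v [N uN] [N' vN]|N] := gen P _ _ _ _ (iota g)^-1.
- by move=> r; exists 0; rewrite mul1r; apply: integral_id.
- exists 1%N; rewrite /f (bigD1 i) //= mulrC rmorphM mulrA [x i * _]mulrC.
  apply: integral_mul; last exact: integral_id.
  exact: integral_scaled_root.
- exists (N + N')%N; rewrite mulrDr exprD; apply: integral_add.
    rewrite [_ ^+ N * _]mulrC -mulrA; apply: integral_mul => //.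
    by rewrite -rmorphXn; apply: integral_id.
  rewrite -mulrA; apply: integral_mul => //.
  by rewrite -rmorphXn; apply: integral_id.
- by exists (N + N')%N; rewrite exprD mulrACA; apply: integral_mul.
case=> q mq /rootP; set w := _ * _ => qw.
have nzig : iota g != 0 by rewrite -(rmorph0 iota) (inj_eq inj).
have wg : w * iota g = iota (f ^+ N) by rewrite /w -mulrA mulVf // mulr1 rmorphXn.
have szq : size q = (size q).-1.+1.
  by rewrite prednK // size_poly_gt0 monic_neq0.
move: szq qw; set d := _.-1 => szq.
rewrite horner_coef size_map_poly_id0; last by rewrite (monicP mq) rmorph1 oner_eq0.
have top : (map_poly iota q)`_d = 1.
  by rewrite coef_map /= /d -lead_coefE (monicP mq) rmorph1.
rewrite szq big_ord_recr /= top mul1r.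
case: d szq {top} => [|d] szq; first by rewrite big_ord0 add0r => /eqP; rewrite oner_eq0.
move/(congr1 (fun z => z * iota g ^+ d.+1)).
rewrite mul0r mulrDl -exprMn wg mulr_suml => /eqP; rewrite addr_eq0 => /eqP E.
pose h := - \sum_(i < d.+1) q`_i * f ^+ (N * i) * g ^+ (d - i).
have /eqP := ng (N * d.+1)%N h; apply; apply: inj.
rewrite exprM rmorphXn -[RHS]opprK -E /h !rmorphM rmorphN mulNr rmorph_sum.
rewrite mulr_suml; congr (- _); apply: eq_bigr => i _.
rewrite coef_map !rmorphM -!mulrA; congr (_ * _).
have -> : iota g ^+ d.+1 = iota g ^+ i * iota g ^+ (d - i).+1.
  by rewrite -exprD addnS subnKC // -ltnS.
by rewrite [RHS]mulrA -exprMn wg !rmorphXn exprM -exprSr.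
Qed.

End Adjoin.

(** Over the polynomial ring [R] of a transcendence basis, the field is algebraic
    and finitely generated, so that some [R[1/f]] is a field. No polynomial ring
    in at least one variable has this property, so the basis is empty. *)
Lemma zariski (L k : fieldType) (iota : {rmorphism L -> k}) n (x : 'I_n -> k) :
  (forall u, exists p, u = mmap iota x p) -> forall i, algebraic_elt iota (x i).
Proof.
move=> gen i.
have [R [jota [inj alg ext dich]]] := adjoin_transcendentals (codom x) (fmorph_inj iota).
case: dich => [|notG]; first by apply; apply: alg; apply: codom_f.
case: (goldman_of_algebraic inj (x := x) _ _ notG) => [j|P PR Px PD PM u].
  by apply: alg; apply: codom_f.
have [p ->] := gen u; elim/mpoly_ring_ind: p => [c|j|p q Pp Pq|p q Pp Pq].
- by have [r Er] := ext c; have := PR r; rewrite Er mmapC.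
- by rewrite mmapX mmap1U.
- by rewrite rmorphD; apply: PD.
- by rewrite rmorphM; apply: PM.
Qed.

(** * Formal curves on a smooth scheme *)

Lemma dependent_choice (T : Type) (P : nat -> T -> Prop) (E : nat -> T -> T -> Prop) x0 :
  P 0 x0 -> (forall N x, P N x -> exists2 y, P N.+1 y & E N x y) ->
  exists s : nat -> T, [/\ s 0 = x0, forall N, P N (s N) & forall N, E N (s N) (s N.+1)].
Proof.
move=> P0 step.
have next N (x : {x | P N x}) : {y : {y | P N.+1 y} | E N (sval x) (sval y)}.
  apply: boolp.cid; have [y Py xy] := step N _ (svalP x).
  by exists (exist _ y Py).
pose s := fix s N : {x | P N x} :=
  if N is N'.+1 then sval (next N' (s N')) else exist _ x0 P0.
exists (fun N => sval (s N)); split=> // N; first exact: svalP.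
exact: (svalP (next N (s N))).
Qed.

Section PowerSeriesOrder.
Variable k : fieldType.
Implicit Types (p q : {poly k}).

Lemma dvdp_X p : ('X %| p) = (p.[0] == 0).
Proof. by rewrite -['X]subr0 -polyC0 dvdp_XsubCl. Qed.

Lemma mul_Xn_factor p : p != 0 -> exists i,
  exists2 q, q.[0] != 0 & p = q * 'X^i.
Proof.
move=> nz; have [i [q + Ep]] := multiplicity_XsubC p 0.
rewrite nz rootE /= polyC0 subr0 in Ep * => q0.
by exists i, q.
Qed.

(** The order of vanishing at [0] of a product is the sum of the orders. This is
    what makes the ideal of a formal curve prime. *)
Lemma Xn_dvd_mul a b p q : 'X^(a + b) %| p * q -> 'X^a %| p \/ 'X^b %| q.
Proof.
have [->|nzp] := eqVneq p 0; first by rewrite dvdp0; left.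
have [->|nzq] := eqVneq q 0; first by rewrite dvdp0; right.
have [i [p' p0 ->]] := mul_Xn_factor nzp.
have [j [q' q0 ->]] := mul_Xn_factor nzq.
have [ai _|ia] := leqP a i; first by left; rewrite dvdp_mull // dvdp_exp2l.
have [bj _|jb] := leqP b j; first by right; rewrite dvdp_mull // dvdp_exp2l.
rewrite mulrACA -exprD => dv; exfalso.
have : 'X^((i + j).+1) %| p' * q' * 'X^(i + j).
  by apply: dvdp_trans dv; apply: dvdp_exp2l; rewrite -addSn leq_add // ltnW.
rewrite exprS dvdp_mul2r ?expf_neq0 ?polyX_eq0 // dvdp_X hornerM mulf_eq0.
by rewrite (negbTE p0) (negbTE q0).
Qed.

(** If [N] is the multiplicity of the root [x] of [q], the order of [q] along a
    curve that leaves [x] with velocity [v] is [N]. *)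
Lemma comp_order_bound q x v : q != 0 -> v != 0 ->
  exists N, forall b, 'X^2 %| b - (x%:P + v%:P * 'X) -> ~~ ('X^(N.+2) %| q \Po b).
Proof.
move=> nz nv; have [m [q' + Eq]] := multiplicity_XsubC q x.
rewrite nz rootE /= => q'x; exists m => b /dvdpP[c Eb].
have Ebx : b - x%:P = (v%:P + c * 'X) * 'X.
  by rewrite mulrDl -mulrA -expr2 -Eb; ring.
have b0 : b.[0] = x.
  have := congr1 (fun p => p.[0]) Ebx; rewrite !hornerE => /eqP.
  by rewrite subr_eq0 => /eqP.
rewrite Eq comp_polyM rmorphXn /= comp_polyB comp_polyX comp_polyC Ebx exprMn mulrA.
rewrite -[m.+2]add2n exprD dvdp_mul2r ?expf_neq0 ?polyX_eq0 //.
apply/negP => /(dvdp_trans (dvdp_exp2l 'X (isT : 1 <= 2)%N)).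
rewrite expr1 dvdp_X hornerM horner_comp b0 mulf_eq0 (negbTE q'x) horner_exp.
by rewrite !hornerE expf_eq0 (negbTE nv) andbF.
Qed.

Lemma Xn_ideal N : exists J : idealr {poly k}, forall p, (p \in J) = ('X^(N.+1) %| p).
Proof.
pose P : {poly k} -> bool := fun p => 'X^(N.+1) %| p.
have PE p : (p \in P) = ('X^(N.+1) %| p) by [].
have idP : idealr_closed P.
  split; rewrite ?PE ?dvdp0 //.
    by rewrite dvdp1 size_polyXn.
  by move=> a u v; rewrite !PE => Pu Pv; rewrite dvdp_add // dvdp_mull.
by exists (pack_ideal idP).
Qed.

End PowerSeriesOrder.

(** The morphism [pi] is a solution [xi] of the equations in the field [k]. The
    indeterminate of [{poly k}] is the parameter of the curve. *)
Section Curve.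
Variables (L k : fieldType) (n : nat) (pi : {rmorphism {mpoly L[n]} -> k}).
Variable F : 'I_n -> {mpoly L[n]}.
Hypothesis smF : smooth F.
Hypothesis F0 : forall i, pi (F i) = 0.

Let iota : {rmorphism L -> k} := pi \o @mpolyC n L.
Let phi : {rmorphism L -> {poly k}} := polyC \o iota.
Let xi j := pi 'X_j.

Let pi_mmap p : pi p = mmap iota xi p.
Proof. by rewrite mmap_generic_point. Qed.

Lemma mmap_congr (b b' : 'I_n -> {poly k}) d p :
  (forall j, d %| b' j - b j) -> d %| mmap phi b' p - mmap phi b p.
Proof.
move=> db; elim/mpoly_ring_ind: p => [c|i|p q IHp IHq|p q IHp IHq].
- by rewrite !mmapC subrr dvdp0.
- by rewrite !mmapX !mmap1U.
- by rewrite !rmorphD opprD addrACA dvdp_add.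
- rewrite !rmorphM /=; set u' := mmap _ b' p; set w' := mmap _ b' q.
  set u := mmap _ b p; set w := mmap _ b q.
  have -> : u' * w' - u * w = (u' - u) * w' + u * (w' - w) by ring.
  by apply: dvdp_add; [apply: dvdp_mulr | apply: dvdp_mull].
Qed.

Lemma tangent_vector : pi (jacobian F) = 0 -> exists2 v : 'I_n -> k,
  exists j, v j != 0 & forall i, \sum_j pi (F i)^`M(j) * v j = 0.
Proof.
move=> D0; pose A := \matrix_(i, j) pi (F i)^`M(j).
have /eqP/det0P[v nv vA] : \det A^T = 0.
  rewrite det_tr -D0 /jacobian -det_map_mx; congr (\det _).
  by apply/matrixP => i j; rewrite !mxE.
exists (v 0) => [|i].
  apply: boolp.contrapT => nj; move: nv; apply/negP; rewrite negbK; apply/eqP.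
  by apply/rowP => j; rewrite mxE; apply/eqP; apply: boolp.contrapT => /negP vj; apply: nj; exists j.
have := congr1 (fun B : 'rV_n => B 0 i) vA; rewrite !mxE => E; rewrite -[RHS]E.
by apply: eq_bigr => j _; rewrite !mxE mulrC.
Qed.

Definition first_order (v : 'I_n -> k) j : {poly k} := (xi j)%:P + (v j)%:P * 'X.

Lemma mmap_phi_xi p : mmap phi (fun j => (xi j)%:P) p = (pi p)%:P.
Proof. by rewrite pi_mmap (rmorph_mmap iota (@polyC k)). Qed.

Lemma first_order_sol v : (forall i, \sum_j pi (F i)^`M(j) * v j = 0) ->
  forall i, 'X^2 %| mmap phi (first_order v) (F i).
Proof.
move=> tv i; have [h ->] := taylor2 phi (fun j => (xi j)%:P) (fun j => (v j)%:P * 'X) (F i).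
rewrite mmap_phi_xi F0 polyC0 add0r; apply: dvdp_add.
  have -> : \sum_j mmap phi (fun j => (xi j)%:P) (F i)^`M(j) * ((v j)%:P * 'X)
    = (\sum_j pi (F i)^`M(j) * v j)%:P * 'X.
    rewrite rmorph_sum mulr_suml; apply: eq_bigr => j _.
    by rewrite mmap_phi_xi rmorphM mulrA.
  by rewrite tv polyC0 mul0r dvdp0.
elim/big_ind: _ => [|u w|j _]; [exact: dvdp0 | exact: dvdp_add |].
elim/big_ind: _ => [|u w|l _]; [exact: dvdp0 | exact: dvdp_add |].
by rewrite mulrACA -expr2 mulrA dvdp_mull.
Qed.

(** Modulo [X^(N + 3)], the multiples of [X^(N + 2)] form an ideal of square
    zero. *)
Lemma lift_solution N (b : 'I_n -> {poly k}) :
  (forall i, 'X^(N.+2) %| mmap phi b (F i)) ->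
  exists2 b' : 'I_n -> {poly k}, forall i, 'X^(N.+3) %| mmap phi b' (F i)
    & forall j, 'X^(N.+2) %| b' j - b j.
Proof.
move=> sol; have [J JE] := Xn_ideal k N.+2.
have idN : ideal_pred (fun p : {poly k} => 'X^(N.+2) %| p).
  by split; [exact: dvdp0 | exact: dvdp_add | move=> a u; apply: dvdp_mull].
have NN (u w : {poly k}) : 'X^(N.+2) %| u -> 'X^(N.+2) %| w -> u * w \in J.
  move=> Nu Nw; rewrite JE; apply: dvdp_trans (dvdp_mul Nu Nw).
  by rewrite -exprD dvdp_exp2l // addSn addnS !ltnS leq_addr.
have [b' Nb' Fb'] := smooth_lift_mod smF idN NN sol.
by exists b' => // i; rewrite -JE.
Qed.

(** The sequence [s] stands for a power series: its term [N] matters modulo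
    [X^(N + 2)] only. *)
Lemma formal_curve v : (forall i, \sum_j pi (F i)^`M(j) * v j = 0) ->
  exists s : nat -> 'I_n -> {poly k},
    [/\ s 0 = first_order v,
        forall N i, 'X^(N.+2) %| mmap phi (s N) (F i)
      & forall N M j, (N <= M)%N -> 'X^(N.+2) %| s M j - s N j].
Proof.
move=> /first_order_sol sol0.
have [s [s0 sol sS]] := dependent_choice
  (P := fun N b => forall i, 'X^(N.+2) %| mmap phi b (F i)) sol0 lift_solution.
exists s; split=> // N M j; elim: M => [|M IHM]; first by rewrite leqn0 => /eqP->; rewrite subrr dvdp0.
rewrite leq_eqVlt => /predU1P[->|lNM]; first by rewrite subrr dvdp0.
rewrite -(subrK (s M j) (s M.+1 j)) -addrA dvdp_add ?IHM //.
by apply: dvdp_trans (sS M j); rewrite dvdp_exp2l.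
Qed.

(** [Q] is the ideal of the polynomials that vanish identically on the formal
    curve issued from [xi] in the direction [v]. An equation over [L] of an
    algebraic coordinate [xi j] that moves to first order vanishes at [xi] but not
    on the curve. *)
Lemma curve_prime v : (forall i, \sum_j pi (F i)^`M(j) * v j = 0) ->
    (exists2 j, v j != 0 & algebraic_elt iota (xi j)) ->
  exists Q : prime_idealr {mpoly L[n]},
    [/\ forall i, F i \in Q, forall p, p \in Q -> pi p = 0
      & exists2 p, pi p = 0 & p \notin Q].
Proof.
move=> tv [j vj [q nzq qj]]; have [s [s0 sol sc]] := formal_curve tv.
pose ev N : {rmorphism {mpoly L[n]} -> {poly k}} := mmap phi (s N).
(* Later terms of [s] do not change the order of vanishing below [N + 2]. *)
have evc N M p : (N <= M)%N -> ('X^(N.+2) %| ev M p) = ('X^(N.+2) %| ev N p).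
  move=> le; rewrite -[ev M p](subrK (ev N p)) dvdp_addr //.
  by apply: mmap_congr => i; apply: sc.
pose P : {mpoly L[n]} -> bool := fun p => boolp.asbool (forall N, 'X^(N.+2) %| ev N p).
have PE p : (p \in P) = boolp.asbool (forall N, 'X^(N.+2) %| ev N p) by [].
have nP p : p \notin P -> exists N, ~~ ('X^(N.+2) %| ev N p).
  rewrite PE => /boolp.asboolPn np; apply: boolp.contrapT => nN; apply: np => N.
  by apply: boolp.contrapT => /negP ?; apply: nN; exists N.
have ev0 p : (ev 0 p).[0] = pi p.
  rewrite /ev /= s0 -[_.[0]]/(horner_eval 0 _) rmorph_mmap pi_mmap.
  congr (mmap _ _ p); apply: boolp.funext => c /=; rewrite /horner_eval ?hornerC //.
  by rewrite /first_order !hornerE.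
have Ppi p : p \in P -> pi p = 0.
  rewrite PE => /boolp.asboolP /(_ 0) /(dvdp_trans (dvdp_exp2l 'X (isT : 1 <= 2)%N)).
  by rewrite expr1 dvdp_X ev0 => /eqP.
have idP : idealr_closed P.
  split.
  - by rewrite PE; apply/boolp.asboolP => N; rewrite rmorph0 dvdp0.
  - by apply/negP => /Ppi/eqP; rewrite rmorph1 oner_eq0.
  - move=> a u w; rewrite !PE => /boolp.asboolP Pu /boolp.asboolP Pw.
    by apply/boolp.asboolP => N; rewrite rmorphD rmorphM dvdp_add // dvdp_mull.
have prP : prime_idealr_closed P.
  move=> u w Puw.
  apply: contraLR Puw; rewrite negb_or => /andP[/nP[N uN] /nP[M wM]].
  rewrite PE; apply/boolp.asboolPn => /(_ (N + M.+2)%N); rewrite rmorphM -!addSn.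
  case/Xn_dvd_mul; rewrite evc ?leq_addr ?(negbTE uN) //.
  by rewrite (negbTE wM).
by rewrite !addnS leqW // leqW // leq_addl.
exists (pack_prime idP prP); split=> [i|p /Ppi//|].
  by rewrite [_ \in _]PE; apply/boolp.asboolP => N; apply: sol.
exists (map_poly (@mpolyC n L) q).['X_j].
  by rewrite -horner_map -map_poly_comp; apply/rootP.
have nzq' : map_poly iota q != 0 by rewrite map_poly_eq0.
have [N Nb] := comp_order_bound (xi j) nzq' vj.
rewrite [_ \in _]PE; apply/boolp.asboolPn => /(_ N); apply/negP.
rewrite -horner_map -map_poly_comp.
have -> : ev N 'X_j = s N j by rewrite /ev /= mmapX mmap1U.
have -> : map_poly (ev N \o @mpolyC n L) q = map_poly polyC (map_poly iota q).
  by rewrite -map_poly_comp; apply: eq_map_poly => c /=; rewrite mmapC.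
by apply: Nb; have := sc 0 N j (leq0n N); rewrite s0.
Qed.

End Curve.

(** * The generic fibre *)

Lemma zero_dim_no_chain (L : fieldType) n (F : 'I_n -> {mpoly L[n]})
    (P Q : prime_idealr {mpoly L[n]}) :
  zero_dim_ci F -> (forall i, F i \in P) -> {subset P <= Q} -> {subset Q <= P}.
Proof.
case=> d [_ nchain] dn FP PQ; apply: boolp.contrapT => nQP; apply: nchain.
have -> : d = 0 by apply/eqP; rewrite -(eqn_add2r n) dn add0n.
exists (fun i => if i is 0 then P else Q); split=> [i _ r|[|//] _].
  by move/(gen_ideal_sub FP); case: i => [|i] // /PQ.
by split.
Qed.

(** A singular point of the Jacobian matrix has a tangent vector, hence a formal
    curve through it, whose ideal gives a chain of length one. *)
Lemma smooth_elim1 (L : fieldType) n (F : 'I_n -> {mpoly L[n]}) :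
  smooth F -> zero_dim_ci F -> elim_ideal F 1.
Proof.
move=> smF zdF; apply: boolp.contrapT; rewrite /elim_ideal mpolyC1 => J1.
have [M maxM JM] := exists_maximal_prime (jac_ideal_pred F) J1.
pose pi : {rmorphism _ -> residue_field M} := to_residue_field M.
have pi0 p : pi p = 0 <-> p \in M.
  by rewrite -to_residue_field_eq0; split=> [->//|/eqP].
have FM i : F i \in M.
  apply: JM; exists (F i), 0; rewrite mul0r addr0; split=> //.
  exact: gen_ideal_gen.
have DM : jacobian F \in M.
  apply: JM; exists 0, 1; rewrite mul1r add0r; split=> //.
  by case: (gen_ideal_pred F).
have F0 i : pi (F i) = 0 by apply/pi0.
have [v [j vj] tv] := @tangent_vector _ _ _ pi F ((pi0 _).2 DM).
have alg : algebraic_elt (pi \o @mpolyC n L) (pi 'X_j).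
  apply: (@zariski _ _ (pi \o @mpolyC n L) n (fun j => pi 'X_j)) => u.
  have [p ->] := maximal_residue_fieldP maxM u; exists p.
  by rewrite mmap_generic_point.
have [Q [FQ QM [p pM /negP pQ]]] :=
  curve_prime smF F0 tv (ex_intro2 _ _ j vj alg).
apply: pQ; apply: (zero_dim_no_chain (Q := M) zdF FQ) => [q /QM/pi0//|].
exact/pi0.
Qed.

Section ClearDenominators.
Variables (R : idomainType) (p : prime_idealr R).
Hypothesis p0 : forall r, (r \in p) = (r == 0).
Local Notation res := (to_residue_field p).

Let res_eq0 r : (res r == 0) = (r == 0).
Proof. by rewrite to_residue_field_eq0 p0. Qed.

Lemma clear_denominators n (q : {mpoly (residue_field p)[n]}) :
  exists2 r, r != 0 & exists q', (res r)%:MP * q = map_mpoly res q'.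
Proof.
elim/mpoly_ring_ind: q => [c|i|q1 q2|q1 q2].
- have [a [b [bp ->]]] := residue_fieldP c; exists b; first by rewrite -p0.
  by exists a%:MP; rewrite map_mpolyC -mpolyCM mulrC divfK // res_eq0 -p0.
- exists 1; first exact: oner_neq0.
  by exists 'X_i; rewrite map_mpolyX rmorph1 mpolyC1 mul1r.
- move=> [r1 nz1 [q1' E1]] [r2 nz2 [q2' E2]]; exists (r1 * r2); first exact: mulf_neq0.
  exists (r2%:MP * q1' + r1%:MP * q2').
  rewrite rmorphD !rmorphM /= !map_mpolyC -E1 -E2; ring.
- move=> [r1 nz1 [q1' E1]] [r2 nz2 [q2' E2]]; exists (r1 * r2); first exact: mulf_neq0.
  exists (q1' * q2').
  rewrite !rmorphM /= -E1 -E2; ring.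
Qed.

Lemma elim_ideal_generic n (F : 'I_n -> {mpoly R[n]}) :
  elim_ideal (fiber F p) 1 -> exists2 h, elim_ideal F h & h <> 0.
Proof.
have [J0 JD JM] := jac_ideal_pred F.
pose C q := exists2 r, r != 0 & exists2 q', jac_ideal F q' &
  (res r)%:MP * q = map_mpoly res q'.
have CD q1 q2 : C q1 -> C q2 -> C (q1 + q2).
  move=> [r1 nz1 [q1' J1 E1]] [r2 nz2 [q2' J2 E2]].
  exists (r1 * r2); first exact: mulf_neq0.
  exists (r2%:MP * q1' + r1%:MP * q2'); first by apply: JD; apply: JM.
  rewrite rmorphD !rmorphM /= !map_mpolyC -E1 -E2; ring.
have CM a q' : jac_ideal F q' -> C (a * map_mpoly res q').
  move=> Jq; have [r nz [a' Ea]] := clear_denominators a.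
  exists r => //; exists (a' * q'); first exact: JM.
  by rewrite mulrA Ea rmorphM.
move=> [_ [g [[c ->] E]]].
have [r nz [q' Jq Eq]] : C 1.
  rewrite -mpolyC1 E; apply: (CD).
    elim/big_ind: _ => [||i _]; last 1 first.
    - apply: (CM); exists (F i), 0; rewrite mul0r addr0; split=> //.
      exact: gen_ideal_gen.
    - by exists 1; rewrite ?oner_neq0 //; exists 0 => //; rewrite mulr0 rmorph0.
    - exact: CD.
  rewrite jacobian_map; apply: CM; exists 0, 1; rewrite mul1r add0r; split=> //.
  by case: (gen_ideal_pred F).
exists r; last exact/eqP.
rewrite /elim_ideal; suff -> : r%:MP = q' by [].
apply/mpolyP => m; apply/eqP; rewrite -subr_eq0 -res_eq0 rmorphB subr_eq0.
by rewrite -!(mcoeff_map_mpoly res) map_mpolyC -Eq mulr1.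
Qed.

End ClearDenominators.

(** A dense open set contains the generic point [eta], and the elimination ideal
    can be computed on the generic fibre up to denominators. If this fibre is
    empty, [1] is already in the ideal of the equations. *)
Lemma I_smooth_elim (R : idomainType) n (F : 'I_n -> {mpoly R[n]}) U :
  I_smooth F U -> exists2 h, elim_ideal F h & h <> 0.
Proof.
case=> [[E UE] denseU _ fibU]; have [eta eta0] := zero_prime R.
have [||p [/UE[r Er rp] _]] := denseU (fun=> True).
- by exists (eq 1) => p; split=> // _; exists 1; rewrite ?idealr1.
- by exists eta.
have Ueta : U eta.
  by apply/UE; exists r => //; rewrite eta0; apply: contraNneq rp => ->; apply: rpred0.
apply: (elim_ideal_generic eta0).
have [[q1]|n1] := boolp.pselect (gen_ideal (fiber F eta) 1).
  move=> E1; exists 1, 0; rewrite mul0r addr0; split; last exact: mpolyC1.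
  by exists q1.
by have [zd sm] := fibU _ Ueta n1; apply: smooth_elim1.
Qed.

Theorem theorem2p12 (K : fieldType) (m n : nat)
    (f : 'I_n -> {mpoly K[n]}) (F : 'I_n -> {mpoly {mpoly K[m]}[n]}) :
  zero_dim_ci f ->
  generically_zero_dim_family F f ->
  independent_params F ->
  ((exists U : prime_idealr {mpoly K[m]} -> Prop, I_smooth F U) <->
   (exists2 h : {mpoly K[m]}, elim_ideal F h & h <> 0)) /\
  (forall h : {mpoly K[m]}, h <> 0 -> elim_ideal F h ->
     I_smooth F (basic_open h)).
Proof.
move=> _ _ _.
have partb (h : {mpoly K[m]}) : h <> 0 -> elim_ideal F h -> I_smooth F (basic_open h).
  by move/eqP; apply: basic_open_I_smooth.
split=> //; split=> [[U] | [h Fh nz]]; first exact: I_smooth_elim.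
by exists (basic_open h); apply: partb.
Qed.
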